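(* Let $k\ge 1$ be an integer and $n\in\{8k,\,8k+2\}$. Define the edge set $T_n=T'_n\cup T''_n\cup T'''_n\cup \bar T_n$ on vertex set $\{0,1,\ldots,n-1\}$ by: if $n=8k$, $T'_n=\{\{1+i,\,8k-2-i\}: i=0,1,\ldots,2k-3\}$, $T''_n=\{\{2k+i,\,6k-i\}: i=0,1,\ldots,k-1\}$, $T'''_n=\{\{3k+i,\,5k-2-i\}: i=0,1,\ldots,k-2\}$, $\bar T_n=\{\{0,4k-1\},\{2k-1,8k-1\},\{5k-1,5k\}\}$; if $n=8k+2$, $T'_n=\{\{1+i,\,8k-i\}: i=0,1,\ldots,2k-2\}$, $T''_n=\{\{2k+1+i,\,6k+1-i\}: i=0,1,\ldots,k-1\}$, $T'''_n=\{\{3k+1+i,\,5k-1-i\}: i=0,1,\ldots,k-2\}$, $\bar T_n=\{\{0,2k\},\{4k,8k+1\},\{5k,5k+1\}\}$ (an index range with upper bound smaller than $0$ gives the empty set). Then $T_n$ is a rainbow perfect matching in $K^\bullet_n$.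
   Context: For an integer $n\ge 1$, $K^\bullet_n$ denotes the complete graph on vertex set $V=\{0,1,\ldots,n-1\}$ whose edges are colored by the circular-distance edge coloring: the edge $\{i,j\}$ receives color $c_{\min\{|i-j|,\,n-|i-j|\}}$, where $c_1,c_2,\ldots$ are distinct colors. Thus exactly $\lfloor n/2\rfloor$ colors are used. A rainbow matching is a matching (set of pairwise vertex-disjoint edges) whose edges have pairwise distinct colors. For $n$ even, a rainbow perfect matching in $K^\bullet_n$ is a rainbow matching covering all $n$ vertices. *)

(* Defs.v *)
From HB Require Import structures.
From mathcomp Require Import all_boot all_order ssralg ssrint.

Set Implicit Arguments.
Unset Strict Implicit.
Unset Printing Implicit Defensive.

Local Open Scope nat_scope.

Definition complete_edges (n : nat) : {set {set 'I_n}} :=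
  [set e : {set 'I_n} | #|e| == 2].

(* The subtraction inside the bars is that of int, hence not truncated. *)
Definition circ_dist (n : nat) (i j : 'I_n) : nat :=
  minn `|i - j|%N (n - `|i - j|%N).

Lemma circ_distC (n : nat) (i j : 'I_n) : circ_dist i j = circ_dist j i.
Proof. by rewrite /circ_dist distnC. Qed.

(* The color c_d is represented by its index d.  The value does not depend on *)
(* the endpoints that are picked (edge_colorE); on a set that is not an edge  *)
(* the junk value is 0, which is not the index of a color.                    *)
Definition edge_color (n : nat) (e : {set 'I_n}) : nat :=
  if [pick p : 'I_n * 'I_n | (p.1 != p.2) && (e == [set p.1; p.2])] is Some p
  then circ_dist p.1 p.2 else 0.

Lemma edge_colorE (n : nat) (i j : 'I_n) :
  i != j -> edge_color [set i; j] = circ_dist i j.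
Proof.
move=> ij; rewrite /edge_color; case: pickP => [[a b] /= /andP[ab /eqP E]|].
  have : a \in [set i; j] by rewrite E set21.
  have : b \in [set i; j] by rewrite E set22.
  rewrite !inE => /orP[]/eqP eb /orP[]/eqP ea; subst a b.
  - by rewrite eqxx in ab.
  - exact: circ_distC.
  - by [].
  - by rewrite eqxx in ab.
by move=> /(_ (i, j)); rewrite /= ij eqxx.
Qed.

Definition matching (n : nat) (M : {set {set 'I_n}}) : Prop :=
  M \subset complete_edges n /\ trivIset M.

Definition rainbow_matching (n : nat) (M : {set {set 'I_n}}) : Prop :=
  matching M /\ {in M &, injective (@edge_color n)}.

Definition rainbow_perfect_matching (n : nat) (M : {set {set 'I_n}}) : Prop :=
  rainbow_matching M /\ cover M = [set: 'I_n].

(* The set {a, b}, for a and b given as natural numbers.  A number outside    *)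
(* {0, ..., n-1} would contribute no element, and the result would then not   *)
(* belong to complete_edges n.                                                *)
Definition pair_set (n a b : nat) : {set 'I_n} :=
  [set x : 'I_n | (val x == a) || (val x == b)].

(* Below, k >= 1 and n is 8k or 8k + 2.  The ordinal bound is the number of   *)
(* values of the index i, and none of the subtractions is truncated.          *)
Definition T' (k n : nat) : {set {set 'I_n}} :=
  if n == 8 * k
  then [set pair_set n (1 + i) (8 * k - 2 - i) | i : 'I_(2 * k - 2)]
  else [set pair_set n (1 + i) (8 * k - i) | i : 'I_(2 * k - 1)].

Definition T'' (k n : nat) : {set {set 'I_n}} :=
  if n == 8 * k
  then [set pair_set n (2 * k + i) (6 * k - i) | i : 'I_k]
  else [set pair_set n (2 * k + 1 + i) (6 * k + 1 - i) | i : 'I_k].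

Definition T''' (k n : nat) : {set {set 'I_n}} :=
  if n == 8 * k
  then [set pair_set n (3 * k + i) (5 * k - 2 - i) | i : 'I_(k - 1)]
  else [set pair_set n (3 * k + 1 + i) (5 * k - 1 - i) | i : 'I_(k - 1)].

Definition Tbar (k n : nat) : {set {set 'I_n}} :=
  if n == 8 * k
  then [set pair_set n 0 (4 * k - 1);
            pair_set n (2 * k - 1) (8 * k - 1);
            pair_set n (5 * k - 1) (5 * k)]
  else [set pair_set n 0 (2 * k);
            pair_set n (4 * k) (8 * k + 1);
            pair_set n (5 * k) (5 * k + 1)].

Definition T (k n : nat) : {set {set 'I_n}} :=
  T' k n :|: T'' k n :|: T''' k n :|: Tbar k n.

(* Main.v *)
Require Import Defs.
From mathcomp Require Import all_boot.
From mathcomp Require Import ssrint zify.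

(** The families T', T'' and T''' consist of pairs with a constant sum, so
    along each of them the difference of the endpoints drops by 2.  In T' the
    differences are odd and exceed n / 2, so its colors are the odd numbers
    3, 5, ...; T'' and T''' give the even colors from 4k down to 2k + 2 and
    from 2k - 2 down to 2.  The three edges of Tbar supply the missing colors 1,
    2k and the largest odd one (4k - 1 if n = 8k, 4k + 1 if n = 8k + 2). *)

Lemma pair_setE (n a b : nat) (ha : a < n) (hb : b < n) :
  pair_set n a b = [set Ordinal ha; Ordinal hb].
Proof. by apply/setP=> x; rewrite !inE. Qed.

Lemma card_pair_set (n a b : nat) : a < b -> b < n -> #|pair_set n a b| = 2.
Proof.
move=> ab bn; rewrite (pair_setE _ _ _ (ltn_trans ab bn) bn) cards2.
by rewrite -val_eqE /= neq_ltn ab.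
Qed.

Lemma edge_color_pair_set (n a b : nat) : a < b -> b < n ->
  edge_color (pair_set n a b) = minn (b - a) (n - (b - a)).
Proof.
move=> ab bn; rewrite (pair_setE _ _ _ (ltn_trans ab bn) bn) edge_colorE.
  by rewrite /circ_dist /= distnC distnEl // ltnW.
by rewrite -val_eqE /= neq_ltn ab.
Qed.

(** Transfers the problem from sets of ordinals to natural numbers. As [R] lists every edge with its
    smaller endpoint first, equality of edges becomes [a = c /\ b = d], and the premises on [R] are
    within reach of [lia]. *)
Lemma rainbow_perfect_matchingP (n : nat) (R : nat -> nat -> Prop)
    (M : {set {set 'I_n}}) :
  (forall e, e \in M <-> exists a b, R a b /\ e = pair_set n a b) ->
  (forall a b, R a b -> a < b /\ b < n) ->
  (forall a b c d x, R a b -> R c d -> x = a \/ x = b -> x = c \/ x = d ->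
     a = c /\ b = d) ->
  (forall a b c d, R a b -> R c d ->
     minn (b - a) (n - (b - a)) = minn (d - c) (n - (d - c)) ->
     a = c /\ b = d) ->
  (forall x, x < n -> exists a b, R a b /\ (x = a \/ x = b)) ->
  rainbow_perfect_matching M.
Proof.
move=> MP Rlt Rdisj Rcol Rcov; split; first split; first split.
- apply/subsetP=> e /MP[a [b [Rab ->]]]; have [ab bn] := Rlt _ _ Rab.
  by rewrite inE card_pair_set.
- apply/trivIsetP=> _ _ /MP[a [b [Rab ->]]] /MP[c [d [Rcd ->]]] neq.
  apply/pred0P=> x /=; apply: contraNF neq; rewrite !inE => /andP[xab xcd].
  have xabE : val x = a \/ val x = b by case/orP: xab => /eqP; [left | right].
  have xcdE : val x = c \/ val x = d by case/orP: xcd => /eqP; [left | right].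
  by have [-> ->] := Rdisj _ _ _ _ _ Rab Rcd xabE xcdE.
- move=> _ _ /MP[a [b [Rab ->]]] /MP[c [d [Rcd ->]]].
  have [ab bn] := Rlt _ _ Rab; have [cd dn] := Rlt _ _ Rcd.
  rewrite !edge_color_pair_set // => eq_col.
  by have [-> ->] := Rcol _ _ _ _ Rab Rcd eq_col.
- apply/setP=> x; rewrite inE; apply/bigcupP.
  have [a [b [Rab xab]]] := Rcov _ (ltn_ord x).
  exists (pair_set n a b); first by apply/MP; exists a, b.
  by rewrite inE /=; case: xab => ->; rewrite eqxx ?orbT.
Qed.

Lemma pair_set_imsetP (n m : nat) (f g : nat -> nat) (e : {set 'I_n}) :
  e \in [set pair_set n (f i) (g i) | i : 'I_m] <->
  exists i, i < m /\ e = pair_set n (f i) (g i).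
Proof.
split=> [/imsetP[i _ ->] | [i [im ->]]]; first by exists i.
by apply/imsetP; exists (Ordinal im).
Qed.

(** The index [i] is eliminated: a family is given by the range of its smaller endpoint and its
    constant sum, so [b] needs no subtraction. The disjuncts follow the order [T'], [T''], [T'''],
    [Tbar]. *)
Definition edges_8k (k : nat) (a b : nat) : Prop :=
  (1 <= a <= 2 * k - 2 /\ a + b = 8 * k - 1) \/
  (2 * k <= a < 3 * k /\ a + b = 8 * k) \/
  (3 * k <= a < 4 * k - 1 /\ a + b = 8 * k - 2) \/
  (a = 0 /\ b = 4 * k - 1) \/
  (a = 2 * k - 1 /\ b = 8 * k - 1) \/
  (a = 5 * k - 1 /\ b = 5 * k).

Definition edges_8k2 (k : nat) (a b : nat) : Prop :=
  (1 <= a <= 2 * k - 1 /\ a + b = 8 * k + 1) \/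
  (2 * k + 1 <= a <= 3 * k /\ a + b = 8 * k + 2) \/
  (3 * k + 1 <= a < 4 * k /\ a + b = 8 * k) \/
  (a = 0 /\ b = 2 * k) \/
  (a = 4 * k /\ b = 8 * k + 1) \/
  (a = 5 * k /\ b = 5 * k + 1).

Ltac lia_in_disjunct :=
  solve [left; lia_in_disjunct | right; lia_in_disjunct | lia].
Ltac lia_by_cases :=
  intros; repeat match goal with H : _ \/ _ |- _ => destruct H end; lia.

Lemma T_8kP (k : nat) (e : {set 'I_(8 * k)}) : 1 <= k ->
  e \in T k (8 * k) <->
  exists a b, edges_8k k a b /\ e = pair_set (8 * k) a b.
Proof.
move=> hk; rewrite /T /T' /T'' /T''' /Tbar eqxx.
(* Three unions come from [T] and two from the three-element set [Tbar]; flattening leaves six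
   alternatives. *)
rewrite 5!in_setU !in_set1 -!orbA; split.
  move=> /or4P[|||/or3P[]].
  (* Solving the equation between edges first instantiates both endpoints. *)
  - move=> /pair_set_imsetP[i [im ->]]; do 2 eexists; split; last by [].
    by rewrite /edges_8k; lia_in_disjunct.
  - move=> /pair_set_imsetP[i [im ->]]; do 2 eexists; split; last by [].
    by rewrite /edges_8k; lia_in_disjunct.
  - move=> /pair_set_imsetP[i [im ->]]; do 2 eexists; split; last by [].
    by rewrite /edges_8k; lia_in_disjunct.
  1-3: move=> /eqP->; do 2 eexists; split; last by [].
  1-3: by rewrite /edges_8k; lia_in_disjunct.
move=> [a [b [Rab ->]]].
case: Rab => [R1|[R2|[R3|[|[|]]]]].
(* The index is the offset of [a] from the first smaller endpoint of its family. *)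
- apply/or4P/Or41/pair_set_imsetP; exists (a - 1); split; first lia.
  by congr pair_set; lia.
- apply/or4P/Or42/pair_set_imsetP; exists (a - 2 * k); split; first lia.
  by congr pair_set; lia.
- apply/or4P/Or43/pair_set_imsetP; exists (a - 3 * k); split; first lia.
  by congr pair_set; lia.
all: by case=> -> ->; rewrite eqxx !orbT.
Qed.

Lemma T_8k2P (k : nat) (e : {set 'I_(8 * k + 2)}) : 1 <= k ->
  e \in T k (8 * k + 2) <->
  exists a b, edges_8k2 k a b /\ e = pair_set (8 * k + 2) a b.
Proof.
move=> hk; rewrite /T /T' /T'' /T''' /Tbar.
have -> : (8 * k + 2 == 8 * k) = false by lia.
rewrite 5!in_setU !in_set1 -!orbA; split.
  move=> /or4P[|||/or3P[]].
  - move=> /pair_set_imsetP[i [im ->]]; do 2 eexists; split; last by [].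
    by rewrite /edges_8k2; lia_in_disjunct.
  - move=> /pair_set_imsetP[i [im ->]]; do 2 eexists; split; last by [].
    by rewrite /edges_8k2; lia_in_disjunct.
  - move=> /pair_set_imsetP[i [im ->]]; do 2 eexists; split; last by [].
    by rewrite /edges_8k2; lia_in_disjunct.
  1-3: move=> /eqP->; do 2 eexists; split; last by [].
  1-3: by rewrite /edges_8k2; lia_in_disjunct.
move=> [a [b [Rab ->]]].
case: Rab => [R1|[R2|[R3|[|[|]]]]].
- apply/or4P/Or41/pair_set_imsetP; exists (a - 1); split; first lia.
  by congr pair_set; lia.
- apply/or4P/Or42/pair_set_imsetP; exists (a - (2 * k + 1)); split; first lia.
  by congr pair_set; lia.
- apply/or4P/Or43/pair_set_imsetP; exists (a - (3 * k + 1)); split; first lia.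
  by congr pair_set; lia.
all: by case=> -> ->; rewrite eqxx !orbT.
Qed.

(** Since [R] is ordered, [x] may be either endpoint; with this lemma it suffices to name its
    partner [y]. *)
Lemma exists_edge (R : nat -> nat -> Prop) (x y : nat) :
  R x y \/ R y x -> exists a b, R a b /\ (x = a \/ x = b).
Proof. by case; [exists x, y | exists y, x]; auto. Qed.

(** The endpoints [0], [2k-1], [4k-1], [5k-1], [5k], [8k-1] of [Tbar] separate the blocks of smaller
    and larger endpoints of the families; inside a block the partner of [x] is the family's sum
    minus [x]. *)
Lemma edges_8k_cover (k x : nat) : 1 <= k -> x < 8 * k ->
  exists a b, edges_8k k a b /\ (x = a \/ x = b).
Proof.
move=> hk xn; have [x0|x0] := posnP x.
  by apply: (exists_edge _ x (4 * k - 1)); rewrite /edges_8k; lia_in_disjunct.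
have [x1|x1] := ltnP x (2 * k - 1).
  by apply: (exists_edge _ x (8 * k - 1 - x)); rewrite /edges_8k; lia_in_disjunct.
have [x2|x2] := ltnP x (2 * k).
  by apply: (exists_edge _ x (8 * k - 1)); rewrite /edges_8k; lia_in_disjunct.
have [x3|x3] := ltnP x (3 * k).
  by apply: (exists_edge _ x (8 * k - x)); rewrite /edges_8k; lia_in_disjunct.
have [x4|x4] := ltnP x (4 * k - 1).
  by apply: (exists_edge _ x (8 * k - 2 - x)); rewrite /edges_8k; lia_in_disjunct.
have [x5|x5] := ltnP x (4 * k).
  by apply: (exists_edge _ x 0); rewrite /edges_8k; lia_in_disjunct.
have [x6|x6] := ltnP x (5 * k - 1).
  by apply: (exists_edge _ x (8 * k - 2 - x)); rewrite /edges_8k; lia_in_disjunct.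
have [x7|x7] := ltnP x (5 * k).
  by apply: (exists_edge _ x (5 * k)); rewrite /edges_8k; lia_in_disjunct.
have [x8|x8] := ltnP x (5 * k + 1).
  by apply: (exists_edge _ x (5 * k - 1)); rewrite /edges_8k; lia_in_disjunct.
have [x9|x9] := ltnP x (6 * k + 1).
  by apply: (exists_edge _ x (8 * k - x)); rewrite /edges_8k; lia_in_disjunct.
have [x10|x10] := ltnP x (8 * k - 1).
  by apply: (exists_edge _ x (8 * k - 1 - x)); rewrite /edges_8k; lia_in_disjunct.
by apply: (exists_edge _ x (2 * k - 1)); rewrite /edges_8k; lia_in_disjunct.
Qed.

(** Here the endpoints of [Tbar] are [0], [2k], [4k], [5k], [5k+1], [8k+1]. *)
Lemma edges_8k2_cover (k x : nat) : 1 <= k -> x < 8 * k + 2 ->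
  exists a b, edges_8k2 k a b /\ (x = a \/ x = b).
Proof.
move=> hk xn; have [x0|x0] := posnP x.
  by apply: (exists_edge _ x (2 * k)); rewrite /edges_8k2; lia_in_disjunct.
have [x1|x1] := ltnP x (2 * k).
  by apply: (exists_edge _ x (8 * k + 1 - x)); rewrite /edges_8k2; lia_in_disjunct.
have [x2|x2] := ltnP x (2 * k + 1).
  by apply: (exists_edge _ x 0); rewrite /edges_8k2; lia_in_disjunct.
have [x3|x3] := ltnP x (3 * k + 1).
  by apply: (exists_edge _ x (8 * k + 2 - x)); rewrite /edges_8k2; lia_in_disjunct.
have [x4|x4] := ltnP x (4 * k).
  by apply: (exists_edge _ x (8 * k - x)); rewrite /edges_8k2; lia_in_disjunct.
have [x5|x5] := ltnP x (4 * k + 1).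
  by apply: (exists_edge _ x (8 * k + 1)); rewrite /edges_8k2; lia_in_disjunct.
have [x6|x6] := ltnP x (5 * k).
  by apply: (exists_edge _ x (8 * k - x)); rewrite /edges_8k2; lia_in_disjunct.
have [x7|x7] := ltnP x (5 * k + 1).
  by apply: (exists_edge _ x (5 * k + 1)); rewrite /edges_8k2; lia_in_disjunct.
have [x8|x8] := ltnP x (5 * k + 2).
  by apply: (exists_edge _ x (5 * k)); rewrite /edges_8k2; lia_in_disjunct.
have [x9|x9] := ltnP x (6 * k + 2).
  by apply: (exists_edge _ x (8 * k + 2 - x)); rewrite /edges_8k2; lia_in_disjunct.
have [x10|x10] := ltnP x (8 * k + 1).
  by apply: (exists_edge _ x (8 * k + 1 - x)); rewrite /edges_8k2; lia_in_disjunct.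
by apply: (exists_edge _ x (4 * k)); rewrite /edges_8k2; lia_in_disjunct.
Qed.

Theorem theorem2 (k n : nat) (hk : 1 <= k) (hn : n = 8 * k \/ n = 8 * k + 2) :
  rainbow_perfect_matching (T k n).
Proof.
case: hn => ->.
- apply: (rainbow_perfect_matchingP _ (edges_8k k)) =>
    [e|a b|a b c d x|a b c d|x].
  + exact: T_8kP.
  + by rewrite /edges_8k; lia_by_cases.
  + by rewrite /edges_8k; lia_by_cases.
  (* Colors: [2a+1] on [T'], [8k-2a] on [T''], [8k-2-2a] on [T'''], each determining [a]; [Tbar] has
     [4k-1], [2k], [1]. *)
  + by rewrite /edges_8k; lia_by_cases.
  + exact: edges_8k_cover.
- apply: (rainbow_perfect_matchingP _ (edges_8k2 k)) =>
    [e|a b|a b c d x|a b c d|x].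
  + exact: T_8k2P.
  + by rewrite /edges_8k2; lia_by_cases.
  + by rewrite /edges_8k2; lia_by_cases.
  (* Colors: [2a+1], [8k+2-2a], [8k-2a] on the three families; [2k], [4k+1], [1] on [Tbar]. *)
  + by rewrite /edges_8k2; lia_by_cases.
  + exact: edges_8k2_cover.
Qed.
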